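(* Let $R$ be a left and right noetherian ring, $n\geq 1$, and let $0\to A\to B\to C\to 0$ be an exact sequence of finitely generated left $R$-modules. If $B\in R_n(\mathrm{mod}\, R)$ and $C\in R_{n-1}(\mathrm{mod}\, R)$, then $A\in R_n(\mathrm{mod}\, R)$. Hence $R_n(\mathrm{mod}\, R)$ is resolving.
   Context: $\mathrm{mod}\,R$ is the category of finitely generated left $R$-modules. For a module $M$, $0\to M\to I_0(M)\to I_1(M)\to\cdots$ denotes its minimal injective resolution; $I_j(R)$ refers to $R$ as a left $R$-module. $R_n(\mathrm{mod}\,R)$ is the full subcategory of $\mathrm{mod}\,R$ of modules $M$ having the $R_n$-property: for every $0\leq i\leq n-1$, $I_i(M)$ is isomorphic to a direct summand of a direct sum of copies of $\bigoplus_{j\leq i}I_j(R)$ (for $n=0$ the condition is vacuous). A subcategory $\mathcal X$ of $\mathrm{mod}\,R$ is resolving if it contains all finitely generated projective left $R$-modules, is closed under extensions, and is closed under kernels of epimorphisms. *)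

(* Defs.v *)
From HB Require Import structures.
From mathcomp Require Import all_boot all_algebra.
From mathcomp Require Import boolp classical_sets cardinality.
Set Implicit Arguments.
Unset Strict Implicit.
Unset Printing Implicit Defensive.
Import GRing.Theory.
Local Open Scope ring_scope.

(* [lmodType R] is the type of left R-modules. A module carries a choiceType
   structure, which under the classical axioms of boolp is no restriction;
   for the same reason every subset of a module is an element of [{pred M}]. *)

Section FinitelyGenerated.
Variables (R : pzRingType) (M : lmodType R).

Definition fin_gen_pred (N : {pred M}) : Prop :=
  exists s : seq M, forall x : M,
    x \in N <-> exists c : nat -> R, x = \sum_(i < size s) c i *: s`_i.

Definition fin_gen : Prop := fin_gen_pred predT.

Definition noetherian_module : Prop :=
  forall N : {pred M}, GRing.submod_closed N -> fin_gen_pred N.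

Definition essential (K : {pred M}) : Prop :=
  forall N : {pred M}, GRing.submod_closed N ->
    (exists2 x, x \in N & x != 0) ->
    exists x, [/\ x \in N, x \in K & x != 0].

End FinitelyGenerated.

Definition left_noetherian (R : pzRingType) : Prop :=
  @noetherian_module R R^o.

(* Left ideals of the converse ring R^c are the right ideals of R. *)
Definition right_noetherian (R : pzRingType) : Prop := left_noetherian R^c.

Section Homological.
Variable R : pzRingType.

Definition injective_module (E : lmodType R) : Prop :=
  forall (X Y : lmodType R) (f : {linear X -> Y}) (g : {linear X -> E}),
    injective f -> exists h : {linear Y -> E}, h \o f =1 g.

Definition projective_module (P : lmodType R) : Prop :=
  forall (X Y : lmodType R) (f : {linear X -> Y}) (g : {linear P -> Y}),
    (forall y, exists x, f x = y) -> exists h : {linear P -> X}, f \o h =1 g.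

Definition exact_at (X Y Z : lmodType R) (f : {linear X -> Y})
    (g : {linear Y -> Z}) : Prop :=
  forall y, g y = 0 <-> exists x, f x = y.

Definition short_exact (A B C : lmodType R) (f : {linear A -> B})
    (g : {linear B -> C}) : Prop :=
  [/\ injective f, exact_at f g & forall c, exists b, g b = c].

(* The resolution 0 -> M -> I_0 -> I_1 -> ... is minimal when I_0 is an
   injective envelope of M and each I_(j+1) is an injective envelope of the
   cokernel of the map into I_j. By exactness, the image of M in I_0 is the
   kernel of I_0 -> I_1 and the image of that cokernel in I_(j+1) is the kernel
   of I_(j+1) -> I_(j+2); so minimality says that every kernel is essential. *)
Record min_inj_resolution (M : lmodType R) := MinInjResolution {
  res_term :> nat -> lmodType R;
  res_aug : {linear M -> res_term 0%N};
  res_diff : forall j, {linear res_term j -> res_term j.+1};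
  res_injective : forall j, injective_module (res_term j);
  res_aug_inj : injective res_aug;
  res_exact0 : exact_at res_aug (res_diff 0%N);
  res_exactS : forall j, exact_at (res_diff j) (res_diff j.+1);
  res_minimal :
    forall j, @essential R (res_term j) [pred x | res_diff j x == 0]
}.

End Homological.

Section DirectSum.
Variables (R : pzRingType) (K : Type) (M : K -> lmodType R).

Definition fin_supp (f : forall k, M k) : Prop :=
  finite_set [set k | f k != 0]%classic.

Record direct_sum := DirectSum {
  dsum_val :> forall k, M k;
  dsum_fin : fin_supp dsum_val
}.

HB.instance Definition _ := gen_eqMixin direct_sum.
HB.instance Definition _ := gen_choiceMixin direct_sum.

Lemma dsum_ext (f g : direct_sum) : (forall k, f k = g k) -> f = g.
Proof.
case: f g => [f Pf] [g Pg] /= fg.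
have efg : f = g by apply: functional_extensionality_dep.
by case: _ / efg Pg => Pg; congr DirectSum; apply: Prop_irrelevance.
Qed.

Lemma fin_supp0 : fin_supp (fun k => 0).
Proof.
rewrite /fin_supp (_ : [set _ | _]%classic = classical_sets.set0).
  exact: finite_set0.
by rewrite predeqE => k; split => //=; rewrite eqxx.
Qed.

Lemma fin_suppN (f : direct_sum) : fin_supp (fun k => - f k).
Proof.
by apply: sub_finite_set (dsum_fin f) => k /=; rewrite oppr_eq0.
Qed.

Lemma fin_suppD (f g : direct_sum) : fin_supp (fun k => f k + g k).
Proof.
have fgfin : finite_set ([set k | f k != 0] `|` [set k | g k != 0])%classic.
  by rewrite finite_setU; split; apply: dsum_fin.
apply: sub_finite_set fgfin => k /=.
by have [->|] := eqVneq (f k) 0; [rewrite add0r; right | left].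
Qed.

Lemma fin_suppZ (a : R) (f : direct_sum) : fin_supp (fun k => a *: f k).
Proof.
apply: sub_finite_set (dsum_fin f) => k /=.
by apply: contra_neq => ->; rewrite scaler0.
Qed.

Definition dsum0 := DirectSum fin_supp0.
Definition dsum_opp f := DirectSum (fin_suppN f).
Definition dsum_add f g := DirectSum (fin_suppD f g).
Definition dsum_scale a f := DirectSum (fin_suppZ a f).

Fact dsum_addA : associative dsum_add.
Proof. by move=> f g h; apply: dsum_ext => k /=; rewrite addrA. Qed.
Fact dsum_addC : commutative dsum_add.
Proof. by move=> f g; apply: dsum_ext => k /=; rewrite addrC. Qed.
Fact dsum_add0 : left_id dsum0 dsum_add.
Proof. by move=> f; apply: dsum_ext => k /=; rewrite add0r. Qed.
Fact dsum_addN : left_inverse dsum0 dsum_opp dsum_add.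
Proof. by move=> f; apply: dsum_ext => k /=; rewrite addNr. Qed.

HB.instance Definition _ :=
  GRing.isZmodule.Build direct_sum dsum_addA dsum_addC dsum_add0 dsum_addN.

Fact dsum_scaleA a b f : dsum_scale a (dsum_scale b f) = dsum_scale (a * b) f.
Proof. by apply: dsum_ext => k /=; rewrite scalerA. Qed.
Fact dsum_scale1 : left_id 1 dsum_scale.
Proof. by move=> f; apply: dsum_ext => k /=; rewrite scale1r. Qed.
Fact dsum_scaleDr : right_distributive dsum_scale +%R.
Proof. by move=> a f g; apply: dsum_ext => k /=; rewrite scalerDr. Qed.
Fact dsum_scaleDl f : {morph dsum_scale^~ f : a b / a + b}.
Proof. by move=> a b; apply: dsum_ext => k /=; rewrite scalerDl. Qed.

HB.instance Definition _ :=
  GRing.Zmodule_isLmodule.Build R direct_sum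
    dsum_scaleA dsum_scale1 dsum_scaleDr dsum_scaleDl.

End DirectSum.

Section RnProperty.
Variable R : pzRingType.

Definition iso_summand (X Y : lmodType R) : Prop :=
  exists (Z : lmodType R) (f : {linear (X * Z)%type -> Y}), bijective f.

Definition summand_of_copies (X W : lmodType R) : Prop :=
  exists K : Type, iso_summand X (direct_sum (fun _ : K => W)).

(* Minimal injective resolutions are unique up to isomorphism, so I_i(M) and
   I_j(R) may be read off from any choice E of a resolution of M and J of R. *)
Definition Rn_property (n : nat) (M : lmodType R) : Prop :=
  forall i : nat, (i < n)%N ->
    exists (E : min_inj_resolution M) (J : min_inj_resolution R^o),
      summand_of_copies (E i) (direct_sum (fun j : 'I_i.+1 => J j)).

Definition Rn_mod (n : nat) (M : lmodType R) : Prop :=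
  fin_gen M /\ Rn_property n M.

(* The full subcategory of mod R with class of objects X is resolving. *)
Definition resolving (X : lmodType R -> Prop) : Prop :=
  [/\ forall M, X M -> fin_gen M,
      forall P : lmodType R, fin_gen P -> projective_module P -> X P,
      forall (A B C : lmodType R) (f : {linear A -> B}) (g : {linear B -> C}),
        fin_gen A -> fin_gen B -> fin_gen C -> short_exact f g ->
        X A -> X C -> X B
    & forall (A B C : lmodType R) (f : {linear A -> B}) (g : {linear B -> C}),
        fin_gen A -> fin_gen B -> fin_gen C -> short_exact f g ->
        X B -> X C -> X A].

End RnProperty.

(* Main.v *)
Require Import Defs.
From HB Require Import structures.
From mathcomp Require Import all_boot all_order all_algebra all_field.
From mathcomp Require Import boolp classical_sets cardinality.
Set Implicit Arguments.
Unset Strict Implicit.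
Unset Printing Implicit Defensive.
Import Order.TTheory GRing.Theory Num.Theory.
Local Open Scope classical_set_scope.
Local Open Scope ring_scope.

(** Write W_i for the direct sum of I_0(R), ..., I_i(R). The R_n-property asks
    that I_i(M) be a direct summand of copies of W_i for all i < n. It can be
    tested on any injective resolution Q of M, minimal or not
    ([Rn_propertyP]): each term of the minimal resolution of M is a direct
    summand of the corresponding term of Q ([min_res_retract]), and the modules
    that are summands of copies of W_i are closed under direct summands. The
    same comparison shows that this class does not depend on the resolution of
    R chosen to define W_i, and it plainly grows with i and is closed under
    finite products.

    So closure properties come down to writing down resolutions. Let
    0 -> A -> B -> C -> 0 be exact, and let resolutions of its members be given.
    - Lifting B -> C to a chain map I(B) -> I(C) and taking its mapping cone
      resolves A, with terms I_0(B) and then I_(i-1)(C) x I_i(B)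
      ([kernel_resolution]). The shift is what makes the R_(n-1)-property of C
      sufficient.
    - A chain map I(C) -> I(A)[1] representing the extension has a mapping cone
      that resolves B, with terms I_i(A) x I_i(C) ([horseshoe_resolution]).
    - A finitely generated projective module is a direct summand of some R^m,
      and R^m has the R_n-property by the extension case; apply
      [min_res_retract] once more.

    All of this presupposes that minimal injective resolutions exist
    ([min_inj_resolution_exists]), which takes injective envelopes. Modules are
    embedded in modules of characters R -> algC^*, which are injective because
    algC^* is a divisible group, and whose points are separated because algC^*
    contains roots of unity of every order. An envelope is then cut out of an
    injective module by choosing two successive maximal complements.
    All quotients M / N are handled through maps out of M with kernel N, so
    that no quotient module has to be formed. *)

(** * Zorn's lemma, linear maps and submodules *)

(** [Zorn_bigcup] needs P for the union of the empty chain too. Applying it to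
    the sets X such that P holds of the union of G and X moves the base point
    to G, and leaves only nonempty chains to be bounded. *)
Lemma Zorn_above (T : Type) (P : set (set T)) (G : set T) :
    P G ->
    (forall F : set (set T), F !=set0 -> (F `<=` P) ->
       total_on F subset -> P (\bigcup_(X in F) X)) ->
  exists A, [/\ P A, (G `<=` A) &
     forall B, P B -> (A `<=` B) -> (B `<=` A)].
Proof.
move=> PG Pcup.
have [|A [PA maxA]] := @Zorn_bigcup T (fun X => P (G `|` X)).
  move=> F FP Ftot; have [F0|F0] := pselect (F !=set0); last first.
    suff -> : (\bigcup_(X in F) X) = classical_sets.set0 by rewrite setU0.
    by apply/seteqP; split => // x [X FX _]; case: F0; exists X.
  have -> : G `|` \bigcup_(X in F) X =
      \bigcup_(Y in [set G `|` X | X in F]) Y.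
    rewrite bigcup_image; apply/seteqP; split=> x.
      move=> [Gx|[X FX Xx]]; last by exists X => //; right.
      by case: F0 => X FX; exists X => //; left.
    by move=> [X FX [Gx|Xx]]; [left | right; exists X].
  apply: Pcup.
  - by case: F0 => X FX; exists (G `|` X), X.
  - by move=> _ [X FX <-]; apply: FP.
  - by move=> _ _ [X FX <-] [Y FY <-]; case: (Ftot X Y FX FY) => XY;
      [left|right]; apply: setUS.
exists (G `|` A); split=> // B PB GAB b Bb; right.
have GB : (G `|` B) = B by rewrite setUidPr // => x Gx; apply: GAB; left.
apply: contrapT => nAb; apply: (maxA B); last by rewrite GB.
by split=> [x Ax|BA]; [apply: GAB; right | apply/nAb/BA].
Qed.

Section LinearMaps.
Variable R : pzRingType.

Definition mklin (X Y : lmodType R) (f : X -> Y) (lf : linear f) :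
  {linear X -> Y} := HB.pack f (GRing.isLinear.Build R X Y *:%R f lf).

Definition submodule (M : lmodType R) (N : set M) :=
  N 0 /\ forall a u v, N u -> N v -> N (a *: u + v).

(** Submodules are propositional sets, for which Zorn's lemma and images of maps
    are convenient; the algebraic hierarchy wants a boolean predicate, so the
    module carried by a submodule goes through [spred]. *)
Section Submodule.
Variables (M : lmodType R) (N : set M) (subN : submodule N).

Definition spred of submodule N : {pred M} := [pred x | `[< N x >]].

Fact spred_closed : GRing.submod_closed (spred subN).
Proof.
case: subN => N0 Nl; split=> [|a u v]; first exact/asboolP.
by move=> /asboolP Nu /asboolP Nv; apply/asboolP; apply: Nl.
Qed.
HB.instance Definition _ := GRing.isSubmodClosed.Build R M (spred subN) spred_closed.

Record smod := SMod { smod_val :> M; smod_in : smod_val \in spred subN }.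
HB.instance Definition _ := [isSub for smod_val].
HB.instance Definition _ := [Choice of smod by <:].
HB.instance Definition _ := [SubChoice_isSubLmodule of smod by <:].

Lemma smodP (x : smod) : N x. Proof. by case: x => x /= /asboolP. Qed.
Definition smk x (Nx : N x) : smod := SMod (asboolT Nx : x \in spred subN).
Definition smod_incl : {linear smod -> M} := \val.
End Submodule.
End LinearMaps.

(** * Characters of abelian groups *)

Section Characters.
Variable Y : zmodType.

(** A character of Y is a homomorphism to the multiplicative group of algC.
    Values are nonzero by [character_neq0]. *)
Definition character (chi : Y -> algC) :=
  chi 0 = 1 /\ forall x y, chi (x + y) = chi x * chi y.

(** Graphs of homomorphisms to algC^* from a subgroup of Y. The last condition
    makes the graph functional, as the ratio of two values at one point is a
    value at 0; it also excludes the value 0, since 0 / 0 = 0. *)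
Definition pchar (G : set (Y * algC)) :=
  [/\ G (0, 1),
      forall x y z w, G (x, z) -> G (y, w) -> G (x - y, z / w) &
      forall z, G (0, z) -> z = 1].

Lemma pchar_neq0 G y z : pchar G -> G (y, z) -> z != 0.
Proof.
move=> [_ GB G0] Gy; apply/eqP => z0; have := GB _ _ _ _ Gy Gy.
by rewrite subrr z0 mul0r => /G0/esym/eqP; rewrite oner_eq0.
Qed.

Lemma pcharV G y z : pchar G -> G (y, z) -> G (- y, z^-1).
Proof. by move=> [G1 GB _] Gy; have := GB _ _ _ _ G1 Gy; rewrite sub0r div1r. Qed.

Lemma pcharD G x y z w : pchar G -> G (x, z) -> G (y, w) -> G (x + y, z * w).
Proof.
move=> pG Gx /(pcharV pG) Gy; have [_ GB _] := pG.
by have := GB _ _ _ _ Gx Gy; rewrite opprK invrK.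
Qed.

Lemma pcharMz G y z (k : int) : pchar G -> G (y, z) -> G (y *~ k, z ^ k).
Proof.
move=> pG Gy; have [G1 _ _] := pG.
have GN (n : nat) : G (y *~ n, z ^ n).
  elim: n => [|n IHn]; first by rewrite mulr0z expr0z.
  by rewrite -pmulrn mulrS exprSz; apply: pcharD => //; rewrite pmulrn.
case: k => n //; rewrite NegzE mulrNz -exprnN.
exact: pcharV.
Qed.

(** If some positive multiple of y lies in the domain of G, let n be the least
    one: the multiples of y in the domain are then exactly those of n y, so the
    only requirement on the value z at y is that z ^+ n be the value at n y.
    When that value is 1 a primitive root of unity is chosen, so that z is not 1
    unless n = 1, that is, unless y is already in the domain. If no positive
    multiple is in the domain, any nonzero z will do. *)
Lemma pchar_root G y : pchar G -> exists z,
  [/\ z != 0, forall k w, G (y *~ k, w) -> w = z ^ k &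
      (forall w, ~ G (y, w)) -> z != 1].
Proof.
move=> pG; have [G1 GB G0] := pG.
have [exn|none] :=
    pselect (exists n, `[< (0 < n)%N /\ exists w, G (y *~ n%:Z, w) >]).
  have [n /asboolP[n_gt0 [w0 Gw0]] n_min] := ex_minnP exn.
  have w0_neq0 := pchar_neq0 pG Gw0.
  have [z zn z1] : exists2 z : algC, z ^+ n = w0 &
      (forall w, ~ G (y, w)) -> z != 1.
    have [w01|w0n1] := eqVneq w0 1; last first.
      exists (n.-root w0); first by rewrite rootCK.
      move=> _; apply: contra_neq w0n1 => r1.
      by rewrite -(rootCK n_gt0 w0) r1 expr1n.
    have [z zn] := C_prim_root_exists n_gt0.
    exists z; first by rewrite w01 prim_expr_order.
    move=> nG; apply/eqP => z1.
    have : (n %| 1)%N by rewrite (prim_order_dvd zn) z1 expr1n.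
    by rewrite dvdn1 => /eqP n1; move: Gw0; rewrite n1 mulr1z => /nG.
  have z_neq0 : z != 0 by apply: contraNneq w0_neq0 => z0; rewrite -zn z0 expr0n gtn_eqF.
  exists z; split=> // k w Gk.
  have nz_gt0 : 0 < n%:Z :> int by [].
  have n_neq0 : n%:Z != 0 :> int by rewrite eqz_nat -lt0n.
  have Gr : G (y *~ (k %% n)%Z, w / w0 ^ (k %/ n)%Z).
    have := GB _ _ _ _ Gk (pcharMz (k %/ n)%Z pG Gw0).
    by rewrite -mulrzA -mulrzBr /modz mulrC.
  have r0 : (k %% n)%Z = 0.
    have := modz_ge0 k n_neq0; have := ltz_pmod k nz_gt0.
    move: Gr; case: (k %% n)%Z => // -[|r] // Gr rn _.
    have : (n <= r.+1)%N by apply: n_min; apply/asboolP; split=> //; eexists; exact: Gr.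
    by rewrite leqNgt; move: rn; rewrite ltz_nat => ->.
  move: Gr; rewrite r0 mulr0z => /G0 wE.
  rewrite (divz_eq k n) r0 addr0 mulrC -exprz_exp -[z ^ n%:Z]/(z ^+ n) zn.
  by rewrite -[LHS](@divfK _ (w0 ^ (k %/ n)%Z)) ?wE ?mul1r // expfz_neq0.
exists 2; split; [by rewrite pnatr_eq0 | |
  by move=> _; rewrite -subr_eq0 (addrK 1 1) oner_eq0].
move=> k w Gk; have [k0|k_neq0] := eqVneq k 0.
  by rewrite k0 expr0z; apply: G0; rewrite k0 mulr0z in Gk.
case: none; exists `|k|%N; apply/asboolP; split; first by rewrite absz_gt0.
have [k_ge0|k_lt0] := lerP 0 k.
  by exists w; rewrite gez0_abs.
by exists w^-1; rewrite ltz0_abs // mulrNz; apply: pcharV.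
Qed.

Definition adjoin (G : set (Y * algC)) y z : set (Y * algC) :=
  [set p | exists a w (k : int), G (a, w) /\ p = (a + y *~ k, w * z ^ k)].

Lemma pchar_adjoin G y z : pchar G -> z != 0 ->
  (forall k w, G (y *~ k, w) -> w = z ^ k) -> pchar (adjoin G y z).
Proof.
move=> pG z0 zE; have [G1 GB G0] := pG; split.
- by exists 0, 1, 0; rewrite mulr0z addr0 expr0z mulr1.
- move=> _ _ _ _ [a [v [k [Ga [-> ->]]]]] [b [w [l [Gb [-> ->]]]]].
  exists (a - b), (v / w), (k - l); split; first exact: GB.
  congr (_, _); first by rewrite mulrzBr opprD addrACA.
  by rewrite expfzDr // invfM mulrACA invr_expz.
- move=> _ [a [w [k [Ga [/esym/eqP ak ->]]]]].
  rewrite addr_eq0 in ak; move: Ga; rewrite (eqP ak) -mulrNz => /zE ->.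
  by rewrite -expfzDr // addNr.
Qed.

Lemma adjoin_sub G y z : (G `<=` adjoin G y z).
Proof. by case=> a w Ga; exists a, w, 0; rewrite mulr0z addr0 expr0z mulr1. Qed.

Lemma adjoin_in G y z : pchar G -> adjoin G y z (y, z).
Proof. by case=> G1 _ _; exists 0, 1, 1; rewrite mulr1z add0r mul1r. Qed.

(** A maximal graph has domain Y, for otherwise [pchar_root] would give a value
    at a further point. *)
Lemma pchar_extend G : pchar G ->
  exists2 chi, character chi & forall y z, G (y, z) -> chi y = z.
Proof.
move=> pG; have [|A [pA GA maxA]] := Zorn_above pG.
  move=> F [X0 FX0] Fp Ftot; split.
  - by exists X0 => //; case: (Fp _ FX0).
  - move=> x y z w [X1 FX1 X1x] [X2 FX2 X2y].
    have [X12|X21] := Ftot _ _ FX1 FX2.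
      by exists X2 => //; have [_ XB _] := Fp _ FX2; apply: XB => //; apply: X12.
    by exists X1 => //; have [_ XB _] := Fp _ FX1; apply: XB => //; apply: X21.
  - by move=> z [X FX Xz]; have [_ _] := Fp _ FX; apply.
have [A1 AB A0] := pA.
have totA y : exists z, A (y, z).
  have [z [z0 zE _]] := pchar_root y pA; exists z.
  apply: maxA (pchar_adjoin pA z0 zE) (@adjoin_sub _ _ _) _ _.
  exact: adjoin_in.
have [chi chiA] := choice totA.
have funA y z : A (y, z) -> chi y = z.
  move=> Ay; have := AB _ _ _ _ (chiA y) Ay; rewrite subrr => /A0.
  by move/(canRL (divfK (pchar_neq0 pA Ay))); rewrite mul1r.
exists chi => [|y z /GA]; last exact: funA.
by split=> [|x y]; apply: funA => //; apply: pcharD.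
Qed.

End Characters.

(** Start from the trivial character of N, give x a value other than 1, and
    extend. *)
Lemma character_separates (Y : zmodType) (N : set Y) x :
    N 0 -> (forall u v, N u -> N v -> N (u - v)) -> ~ N x ->
  exists chi, [/\ character chi, forall u, N u -> chi u = 1 & chi x != 1].
Proof.
move=> N0 NB Nx; pose G : set (Y * algC) := [set p | N p.1 /\ p.2 = 1].
have pG : pchar G.
  split=> [//|u v z w [/= Nu ->] [/= Nv ->]|z [_ //]].
  by split=> /=; [apply: NB | rewrite divr1].
have [z [z0 zE z1]] := pchar_root x pG.
have [chi chiP chiE] := pchar_extend (pchar_adjoin pG z0 zE).
exists chi; split=> // [u Nu|]; first by apply/chiE/adjoin_sub.
rewrite (chiE x z); last exact: adjoin_in.
by apply: z1 => w [].
Qed.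

Lemma character_neq0 (Y : zmodType) (chi : Y -> algC) x :
  character chi -> chi x != 0.
Proof.
move=> [chi0 chiD]; apply: contra_eq_neq (chiD x (- x)) => ->.
by rewrite subrr chi0 mul0r oner_neq0.
Qed.

Lemma characterN (Y : zmodType) (chi : Y -> algC) x :
  character chi -> chi (- x) = (chi x)^-1.
Proof.
move=> chiP; have [chi0 chiD] := chiP.
apply: (mulfI (character_neq0 x chiP)).
by rewrite -chiD subrr chi0 divff ?character_neq0.
Qed.

Lemma character_extend (X Y : zmodType) (f : {additive X -> Y})
    (xi : X -> algC) : injective f -> character xi ->
  exists2 chi : Y -> algC, character chi & forall x, chi (f x) = xi x.
Proof.
move=> f_inj xiP; have [xi0 xiD] := xiP.
have [|chi chiP chiE] := @pchar_extend _ [set (f x, xi x) | x in [set: X]].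
  split.
  - by exists 0; rewrite // raddf0 xi0.
  - move=> _ _ _ _ [x _ [<- <-]] [y _ [<- <-]]; exists (x - y) => //.
    by rewrite raddfB xiD characterN.
  - by move=> _ [x _ [fx0 <-]]; rewrite -xi0; congr xi; apply/f_inj; rewrite raddf0.
by exists chi => // x; apply: chiE; exists x.
Qed.

(** * Modules of characters and enough injective modules *)

(** The product over K of copies of Hom_Z(R, algC^* ), where R acts on a
    character through right multiplication of its argument. Functions from K
    are built into the type so that a single construction serves for the whole
    product. *)
Section Coinduced.
Variables (R : pzRingType) (K : Type).

Record coind := CoInd {
  coind_val :> K -> R -> algC;
  coind_char : forall k, character (coind_val k)
}.

HB.instance Definition _ := gen_eqMixin coind.
HB.instance Definition _ := gen_choiceMixin coind.

Lemma coind_ext (F G : coind) : (forall k r, F k r = G k r) -> F = G.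
Proof.
case: F G => [F PF] [G PG] /= FG.
have eFG : F = G by apply/funext => k; apply/funext => r.
by case: _ / eFG PG => PG; congr CoInd; apply: Prop_irrelevance.
Qed.

Fact coind0_subproof (k : K) : character (fun _ : R => 1).
Proof. by split=> // x y; rewrite mulr1. Qed.
Fact coindN_subproof (F : coind) k : character (fun r => (F k r)^-1).
Proof.
by have [F0 FD] := coind_char F k; split=> [|x y]; rewrite ?F0 ?invr1 // FD invfM.
Qed.
Fact coindD_subproof (F G : coind) k : character (fun r => F k r * G k r).
Proof.
have [[F0 FD] [G0 GD]] := (coind_char F k, coind_char G k).
by split=> [|x y]; rewrite ?F0 ?G0 ?mulr1 // FD GD mulrACA.
Qed.
Fact coindZ_subproof a (F : coind) k : character (fun r => F k (r * a)).
Proof.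
by have [F0 FD] := coind_char F k; split=> [|x y]; rewrite ?mul0r // mulrDl FD.
Qed.

Definition coind0 := CoInd coind0_subproof.
Definition coind_opp F := CoInd (coindN_subproof F).
Definition coind_add F G := CoInd (coindD_subproof F G).
Definition coind_scale a F := CoInd (coindZ_subproof a F).

Fact coind_addA : associative coind_add.
Proof. by move=> F G H; apply: coind_ext => k r /=; rewrite mulrA. Qed.
Fact coind_addC : commutative coind_add.
Proof. by move=> F G; apply: coind_ext => k r /=; rewrite mulrC. Qed.
Fact coind_add0 : left_id coind0 coind_add.
Proof. by move=> F; apply: coind_ext => k r /=; rewrite mul1r. Qed.
Fact coind_addN : left_inverse coind0 coind_opp coind_add.
Proof.
move=> F; apply: coind_ext => k r /=; rewrite mulVf //.
exact: character_neq0 (coind_char F k).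
Qed.
HB.instance Definition _ :=
  GRing.isZmodule.Build coind coind_addA coind_addC coind_add0 coind_addN.

Fact coind_scaleA a b F : coind_scale a (coind_scale b F) = coind_scale (a * b) F.
Proof. by apply: coind_ext => k r /=; rewrite mulrA. Qed.
Fact coind_scale1 : left_id 1 coind_scale.
Proof. by move=> F; apply: coind_ext => k r /=; rewrite mulr1. Qed.
Fact coind_scaleDr : right_distributive coind_scale +%R.
Proof. by move=> a F G; apply: coind_ext => k r. Qed.
Fact coind_scaleDl F : {morph coind_scale^~ F : a b / a + b}.
Proof.
move=> a b; apply: coind_ext => k r /=; rewrite mulrDr.
by have [_ ->] := coind_char F k.
Qed.
HB.instance Definition _ := GRing.Zmodule_isLmodule.Build R coind
  coind_scaleA coind_scale1 coind_scaleDr coind_scaleDl.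

Definition coind_of_characters (Y : lmodType R) (chi : K -> Y -> algC)
  (chiP : forall k, character (chi k)) (y : Y) : coind.
Proof.
exists (fun k r => chi k (r *: y)) => k; have [chi0 chiD] := chiP k.
by split=> [|r s]; rewrite ?scale0r // scalerDl chiD.
Defined.

Lemma coind_of_characters_linear Y chi chiP :
  linear (@coind_of_characters Y chi chiP).
Proof.
move=> a u v; apply: coind_ext => k r /=; have [_ chiD] := chiP k.
by rewrite scalerDr chiD scalerA.
Qed.

(** A linear map X -> Hom_Z(R, algC^* ) is the same thing as a character of X,
    by evaluation at 1; so extending linear maps amounts to extending
    characters. *)
Lemma coind_injective : injective_module coind.
Proof.
move=> X Y f g f_inj; pose xi k x := g x k 1.
have xiP k : character (xi k).
  split=> [|x y]; first by rewrite /xi linear0.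
  by rewrite /xi linearD.
have /choice[chi chiP] k : exists chi : Y -> algC,
    character chi /\ forall x, chi (f x) = xi k x.
  by have [chi] := character_extend f_inj (xiP k); exists chi.
have chiC k := (chiP k).1.
exists (mklin (coind_of_characters_linear chiC)) => x /=.
apply: coind_ext => k r /=; have [_] := chiP k.
by rewrite -linearZ => ->; rewrite /xi linearZ /= mul1r.
Qed.

End Coinduced.

(** The product is indexed by the characters of M that are trivial on N; their
    common kernel is N. *)
Lemma embed_quotient (R : pzRingType) (M : lmodType R) (N : set M) :
    submodule N ->
  exists (E : lmodType R) (d : {linear M -> E}),
    injective_module E /\ forall x, d x = 0 <-> N x.
Proof.
move=> [N0 Nl].
pose K := {chi : M -> algC | character chi /\ forall u, N u -> chi u = 1}.
pose chi (k : K) := sval k.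
have chiP k : character (chi k) by case: (svalP k).
exists (coind R K), (mklin (coind_of_characters_linear chiP)).
split=> [|x]; first exact: coind_injective.
split=> [/= dx|Nx]; last first.
  apply: coind_ext => k r /=; have [_] := svalP k; apply.
  by rewrite -[_ *: _]addr0; apply: Nl.
apply: contrapT => nNx.
have [u v Nu Nv|xi [xiP xiN /eqP]] := character_separates N0 _ nNx.
  by rewrite addrC -scaleN1r; apply: Nl.
apply; pose k : K := exist _ xi (conj xiP xiN).
by have := congr1 (fun F : coind R K => F k 1) dx; rewrite /= scale1r.
Qed.

(** * Injective envelopes *)

Section Envelopes.
Variable R : pzRingType.
Implicit Types M X Y Z : lmodType R.

Lemma submoduleZ M (N : set M) a x : submodule N -> N x -> N (a *: x).
Proof. by move=> [N0 Nl] Nx; rewrite -[_ *: _]addr0; apply: Nl. Qed.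

Lemma submoduleD M (N : set M) x y : submodule N -> N x -> N y -> N (x + y).
Proof. by move=> [N0 Nl] Nx Ny; rewrite -[x]scale1r; apply: Nl. Qed.

Lemma submoduleB M (N : set M) x y : submodule N -> N x -> N y -> N (x - y).
Proof.
by move=> sN Nx Ny; apply: submoduleD => //; rewrite -scaleN1r; apply: submoduleZ.
Qed.

Lemma submodule_range X Y (f : {linear X -> Y}) : submodule (range f).
Proof.
split=> [|a _ _ [x _ <-] [y _ <-]]; first by exists 0; rewrite ?linear0.
by exists (a *: x + y); rewrite ?linearP.
Qed.

Lemma submodule0 M : submodule [set 0 : M].
Proof. by split=> // a _ _ -> ->; rewrite scaler0 addr0. Qed.

(** Maximality is stated through elements: if x is not in K, then the submodule
    generated by K and x meets A nontrivially. *)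
Lemma maximal_complement M (A B : set M) :
    submodule B -> (forall x, A x -> B x -> x = 0) ->
  exists K : set M, [/\ submodule K, B `<=` K, forall x, A x -> K x -> x = 0 &
    forall x, ~ K x -> exists a k, [/\ K k, A (a *: x + k) & a *: x + k != 0]].
Proof.
move=> sB AB0.
have [//|F [K0 FK0] Fp Ftot|K [[sK AK0] BK maxK]] := @Zorn_above M
    [set K | submodule K /\ forall x, A x -> K x -> x = 0] B.
  split=> [|x Ax [K FK Kx]]; last by have [_] := Fp _ FK; apply.
  split=> [|a u v [X1 FX1 X1u] [X2 FX2 X2v]].
    by exists K0 => //; case: (Fp _ FK0) => -[].
  have [X12|X21] := Ftot _ _ FX1 FX2.
    by exists X2 => //; have [[_ Xl] _] := Fp _ FX2; apply: Xl => //; apply: X12.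
  by exists X1 => //; have [[_ Xl] _] := Fp _ FX1; apply: Xl => //; apply: X21.
exists K; split=> // x nKx; apply: contrapT => none; apply: nKx.
pose Kx : set M := [set y | exists a k, K k /\ y = a *: x + k].
apply: (maxK Kx); last by exists 1, 0; rewrite scale1r addr0; case: sK.
  split; last first.
    move=> _ /[swap] -[a [k [Kk ->]]] Aak; apply: contrapT => /eqP nz.
    by case: none; exists a, k.
  split; first by exists 0, 0; rewrite scale0r addr0; case: sK.
  move=> a _ _ [b [k [Kk ->]]] [c [l [Kl ->]]].
  exists (a * b + c), (a *: k + l); split; first by case: sK => _; apply.
  by rewrite scalerDr addrACA scalerA -scalerDl.
by move=> k Kk; exists 0, k; rewrite scale0r add0r.
Qed.

Definition retract X Y :=
  exists (a : {linear X -> Y}) (b : {linear Y -> X}), forall x, b (a x) = x.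

Lemma injective_retract X E : retract X E -> injective_module E -> injective_module X.
Proof.
move=> [a [b ab]] injE Y Z f g f_inj.
have [h hE] := injE Y Z f (a \o g : {linear Y -> E}) f_inj.
exists (b \o h : {linear Z -> X}) => y /=.
by have /= -> := hE y; rewrite ab.
Qed.

(** [essential], tested on the cyclic submodules R x; see [elt_essentialP]. *)
Definition elt_essential M (K : set M) :=
  forall x, x != 0 -> exists a, K (a *: x) /\ a *: x != 0.

Lemma elt_essentialP M (K : set M) (k : {pred M}) : (forall x, K x <-> x \in k) ->
  elt_essential K <-> essential k.
Proof.
move=> Kk; split=> [essK N [N0 Nl] [x Nx /essK[a [/Kk ka nz]]]|essk x x0].
  by exists (a *: x); split=> //; rewrite -[_ *: x]addr0; apply: Nl.
have [||y [/asboolP[a <-] /Kk Ky y0]] := essk [pred y | `[< exists a, a *: x = y >]].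
- split; first by apply/asboolP; exists 0; rewrite scale0r.
  move=> a _ _ /asboolP[b <-] /asboolP[c <-]; apply/asboolP.
  by exists (a * b + c); rewrite scalerDl scalerA.
- by exists x => //; apply/asboolP; exists 1; rewrite scale1r.
- by exists a.
Qed.

(** An injective envelope of the quotient M / N, presented by the composite
    M -> M / N -> env. *)
Record envelope M (N : set M) := Envelope {
  env :> lmodType R;
  env_map : {linear M -> env};
  env_injective : injective_module env;
  env_ker : forall x, env_map x = 0 <-> N x;
  env_essential : elt_essential (range env_map)
}.

(** Embed M / N in an injective module E, with image D. Take K maximal with
    K meeting D trivially, then H containing D and maximal with H meeting K
    trivially. Then D is essential in H, because K + R h meets D for h outside
    K. The projection of H + K onto H extends to an endomorphism phi of E. Any
    endomorphism that fixes D and kills K has kernel exactly K; for phi and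
    phi^2 this yields that the image of phi meets K trivially, hence is H by
    maximality. So H is a direct summand of E, and is injective. *)
Lemma envelope_exists M (N : set M) : submodule N -> exists e : envelope N, True.
Proof.
move=> sN; have [E [d [injE d_ker]]] := embed_quotient sN.
pose D := range d; have sD : submodule D := submodule_range d.
have [|K [sK _ DK0 Kmax]] := @maximal_complement E D [set 0] (submodule0 E).
  by move=> x _ ->.
have [|H [sH DH KH0 Hmax]] := @maximal_complement E K D sD.
  by move=> x Kx Dx; apply: DK0.
have [phi phiE] : exists phi : {linear E -> E}, forall h k, H h -> K k ->
    phi (h + k) = h.
  pose s (p : smod sH * smod sK) : E := smod_val p.1 + smod_val p.2.
  have s_lin : linear s.
    by move=> a [h k] [h' k']; rewrite /s /= scalerDr addrACA.
  have fst_lin : linear (fun p : smod sH * smod sK => smod_val p.1).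
    by move=> a [h k] [h' k'].
  have s_inj : injective (mklin s_lin).
    apply: raddf_inj => -[h k] /eqP; rewrite /= /s /= addr_eq0 => /eqP hk.
    have h0 : smod_val h = 0.
      apply: KH0 (smodP h); rewrite hk -scaleN1r.
      by apply: submoduleZ => //; apply: smodP.
    congr (_, _); apply: val_inj; rewrite //=.
    by apply/eqP; rewrite -oppr_eq0 -hk h0.
  have [phi phiE] := injE _ _ (mklin s_lin) (mklin fst_lin) s_inj.
  by exists phi => h k Hh Kk; have /= := phiE (smk sH Hh, smk sK Kk).
have [H0 K0] : H 0 /\ K 0 by split; [case: sH | case: sK].
have phiH h : H h -> phi h = h by move=> Hh; rewrite -{1}[h]addr0 phiE.
have phiK k : K k -> phi k = 0 by move=> Kk; rewrite -[k]add0r phiE.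
have kerK (psi : {linear E -> E}) :
    (forall x, D x -> psi x = x) -> (forall k, K k -> psi k = 0) ->
  forall x, psi x = 0 -> K x.
  move=> psiD psiK x psix; apply: contrapT => /Kmax[a [k [Kk Dy /eqP]]]; apply.
  by rewrite -(psiD _ Dy) linearP psix (psiK k) // scaler0 addr0.
have ker_phi := kerK phi (fun x Dx => phiH x (DH x Dx)) phiK.
have ker_phi2 x : phi (phi x) = 0 -> K x.
  apply: (kerK (phi \o phi : {linear E -> E})) => [y /DH Hy|k Kk] /=.
    by rewrite !phiH.
  by rewrite (phiK k Kk) linear0.
(* Otherwise R (phi x) + H meets K, in a point phi y with phi (phi y) = 0. *)
have phi_in x : H (phi x).
  apply: contrapT => /Hmax[a [h [Hh Ky /eqP]]]; apply.
  have E1 : a *: phi x + h = phi (a *: x + h) by rewrite linearP (phiH h).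
  rewrite E1; apply/phiK/ker_phi2; rewrite -E1; exact: phiK.
have dH x : H (d x) by apply: DH; exists x.
have dH_lin : linear (fun x => smk sH (dH x)).
  by move=> a x y; apply: val_inj; rewrite /= linearP.
have phi_lin : linear (fun x => smk sH (phi_in x)).
  by move=> a x y; apply: val_inj; rewrite /= linearP.
have injH : injective_module (smod sH).
  apply: injective_retract injE; exists (smod_incl sH), (mklin phi_lin) => h.
  by apply: val_inj; rewrite /= phiH //; apply: smodP.
suff essH : elt_essential (range (mklin dH_lin)).
  suff kerH x : mklin dH_lin x = 0 <-> N x by exists (Envelope injH kerH essH).
  rewrite -d_ker; split=> [e|dx].
    exact: (congr1 (fun h : smod sH => smod_val h) e).
  by apply: val_inj.
move=> h h0; have hK : ~ K (smod_val h).
  move=> Kh; move/eqP: h0; apply; apply: val_inj => /=.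
  by apply: KH0 => //; apply: smodP.
have [a [k [Kk [x _ dx] nz]]] := Kmax _ hK.
(* k = d x - a h lies both in K and in H. *)
have k0 : k = 0.
  apply: KH0 => //; have -> : k = d x - a *: smod_val h by rewrite dx addrC addKr.
  by apply: submoduleB => //; apply: submoduleZ => //; apply: smodP.
rewrite k0 addr0 in dx nz; exists a; split; first by exists x => //; apply: val_inj.
by apply: contra_neq nz => e; apply: (congr1 (fun h : smod sH => smod_val h) e).
Qed.

Definition the_envelope M (N : set M) (sN : submodule N) : envelope N :=
  projT1 (cid (envelope_exists sN)).

(** The state of the construction of a minimal resolution: a module X and the
    submodule N for which X / N is the cokernel still to be resolved. *)
Record stage := Stage {
  stage_mod : lmodType R;
  stage_set : set stage_mod;
  stage_sub : submodule stage_set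
}.

Definition stage_env s : envelope (@stage_set s) := the_envelope (@stage_sub s).

(** Stage 0 is M itself, so I_j is found at stage j+1. *)
Fixpoint stages M n : stage := match n with
  | 0 => Stage (submodule0 M)
  | n.+1 => Stage (submodule_range (env_map (stage_env (stages M n))))
  end.

Lemma min_inj_resolution_exists M : exists E : min_inj_resolution M, True.
Proof.
pose e j := stage_env (stages M j).
unshelve eexists (@MinInjResolution R M (fun j => env (e j)) (env_map (e 0%N))
  (fun j => env_map (e j.+1)) _ _ _ _ _) => //=.
- by move=> j; apply: env_injective.
- by apply: raddf_inj => x /env_ker.
- by move=> y; rewrite env_ker /=; split=> [[x _ <-]|[x <-]]; exists x.
- by move=> j y; rewrite env_ker /=; split=> [[x _ <-]|[x <-]]; exists x.
- move=> j.
  have kerE x : range (env_map (e j)) x <-> x \in [pred x | env_map (e j.+1) x == 0].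
    by rewrite inE -(rwP eqP) env_ker.
  exact: (elt_essentialP kerE).1 (@env_essential _ _ (e j)).
Qed.

End Envelopes.

(** * Comparison of injective resolutions *)

Section Resolutions.
Variable R : pzRingType.
Implicit Types A B C E M Q X Y Z V U : lmodType R.

(** The form in which injectivity is used from here on: g factors through the
    image of f, which is a submodule of Y. *)
Lemma injective_factor X Y E (f : {linear X -> Y}) (g : {linear X -> E}) :
    injective_module E -> (forall x, f x = 0 -> g x = 0) ->
  exists h : {linear Y -> E}, forall x, h (f x) = g x.
Proof.
move=> injE fg; pose S := range f; have sS : submodule S := submodule_range f.
have gE x y : f x = f y -> g x = g y.
  move=> e; apply/eqP; rewrite -subr_eq0 -linearB; apply/eqP/fg.
  by rewrite linearB e subrr.
have /choice[p pE] (y : smod sS) : exists x, f x = smod_val y.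
  by have [x _ xy] := smodP y; exists x.
have gp_lin : linear (fun y => g (p y)).
  move=> a y z; rewrite -linearP; apply: gE.
  by rewrite linearP !pE.
have [|h hE] := injE _ _ (smod_incl sS) (mklin gp_lin); first exact: val_inj.
exists h => x; have Sfx : S (f x) by exists x.
by have /= -> := hE (smk sS Sfx); apply: gE; rewrite pE.
Qed.

Lemma retract_refl X : retract X X.
Proof. by exists idfun, idfun. Qed.

Lemma retract_trans Y X Z : retract X Y -> retract Y Z -> retract X Z.
Proof.
move=> [a [b ab]] [c [d cd]]; exists (c \o a : {linear X -> Z}).
by exists (b \o d : {linear Z -> X}) => x /=; rewrite cd ab.
Qed.

(** One step of the comparison between a minimal resolution E -> E' and another
    resolution Q -> Q'. The conditions on a and b say that they respect the
    kernels of d and q. First a is continued to a'. Then b' is obtained from the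
    map E' x Q -> E' that sends (x, y) to x + d (b y), provided that this map
    vanishes when a' x + q y = 0. If it did not, essentiality of the image of d
    would give, after multiplication by a scalar, such a pair with
    x + d (b y) = d z nonzero. Then x = d (z - b y), so
    a (z - b y) + y is in the kernel of q, and applying b shows that z is in the
    kernel of d, a contradiction. *)
Lemma retract_step (E E' Q Q' : lmodType R) (d : {linear E -> E'}) (q : {linear Q -> Q'})
    (a : {linear E -> Q}) (b : {linear Q -> E}) :
    injective_module E' -> injective_module Q' -> elt_essential (range d) ->
    (forall x, b (a x) = x) ->
    (forall x, d x = 0 -> q (a x) = 0) -> (forall y, q y = 0 -> d (b y) = 0) ->
  exists (a' : {linear E' -> Q'}) (b' : {linear Q' -> E'}),
    [/\ forall x, b' (a' x) = x, forall x, a' (d x) = q (a x) &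
        forall y, b' (q y) = d (b y)].
Proof.
move=> injE' injQ' d_ess ab da qb.
have [a' a'd] : exists a' : {linear E' -> Q'}, forall x, a' (d x) = q (a x).
  exact: injective_factor (q \o a : {linear E -> Q'}) injQ' da.
pose s (p : E' * Q) := a' p.1 + q p.2.
have s_lin : linear s.
  by move=> c [x y] [x' y']; rewrite /s /= !linearP addrACA -scalerDr.
pose t (p : E' * Q) := p.1 + d (b p.2).
have t_lin : linear t.
  by move=> c [x y] [x' y']; rewrite /t /= !linearP addrACA -scalerDr.
have [|b' b'E] := injective_factor (f := mklin s_lin) (g := mklin t_lin) injE'.
  move=> p sp; apply: contrapT => /eqP /d_ess[c [[x _ dx] /eqP]]; apply.
  pose p' := c *: p; have sp' : a' p'.1 + q p'.2 = 0.
    by rewrite -[LHS]/(mklin s_lin p') /p' linearZ_LR sp scaler0.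
  have tp' : d x = p'.1 + d (b p'.2).
    by rewrite dx -[RHS]/(mklin t_lin p') /p' linearZ_LR.
  rewrite /= -dx; have p'1 : p'.1 = d (x - b p'.2).
    by rewrite linearB tp' addrK.
  have : q (a (x - b p'.2) + p'.2) = 0.
    by rewrite (linearD q) -a'd -p'1.
  by move/qb; rewrite (linearD b) ab subrK.
exists a', b'; split=> [x|x|y]; last 2 first.
- exact: a'd.
- by have := b'E (0, y); rewrite /= /s /t /= linear0 !add0r.
- by have := b'E (x, 0); rewrite /= /s /t /= !linear0 !addr0.
Qed.

Arguments res_aug {R M} _.
Arguments res_diff {R M} _ _.
Arguments res_injective {R M} _ _ _ _ _ _ _.
Arguments res_aug_inj {R M} _ _ _ _.
Arguments res_exact0 {R M} _ _.
Arguments res_exactS {R M} _ _ _.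
Arguments res_minimal {R M} _ _ _ _ _.

Record inj_resolution M := InjResolution {
  ires_term :> nat -> lmodType R;
  ires_aug : {linear M -> ires_term 0%N};
  ires_diff : forall j, {linear ires_term j -> ires_term j.+1};
  ires_injective : forall j, injective_module (ires_term j);
  ires_aug_inj : injective ires_aug;
  ires_exact0 : exact_at ires_aug (ires_diff 0%N);
  ires_exactS : forall j, exact_at (ires_diff j) (ires_diff j.+1)
}.

Arguments ires_aug {M} _.
Arguments ires_diff {M} _ _.
Arguments ires_injective {M} _ _ _ _ _ _ _.
Arguments ires_aug_inj {M} _ _ _ _.
Arguments ires_exact0 {M} _ _.
Arguments ires_exactS {M} _ _ _.

Definition min_inj_resolution_forget M (E : min_inj_resolution M) :=
  InjResolution (res_injective E) (res_aug_inj E) (res_exact0 E) (res_exactS E).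

Lemma res_ess0 M (E : min_inj_resolution M) : elt_essential (range (res_aug E)).
Proof.
have kerE x : range (res_aug E) x <-> x \in [pred x | res_diff E 0%N x == 0].
  rewrite inE -(rwP eqP) (res_exact0 E).
  by split=> [[y _ <-]|[y <-]]; exists y.
exact: (elt_essentialP kerE).2 (res_minimal E 0%N).
Qed.

Lemma res_essS M (E : min_inj_resolution M) j :
  elt_essential (range (res_diff E j)).
Proof.
have kerE x : range (res_diff E j) x <-> x \in [pred x | res_diff E j.+1 x == 0].
  rewrite inE -(rwP eqP) (res_exactS E).
  by split=> [[y _ <-]|[y <-]]; exists y.
exact: (elt_essentialP kerE).2 (res_minimal E j.+1).
Qed.

(** By [retract_step], starting from A -> I_0 and B -> Q_0. Respecting the
    kernels of the differentials is the invariant that is carried from each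
    degree to the next. With A = B it compares any two resolutions of A. *)
Lemma min_res_retract A B (E : min_inj_resolution A) (Q : inj_resolution B) i :
  retract A B -> retract (E i) (Q i).
Proof.
move=> [a [b ab]].
suff [a' [b' []]] : exists (a' : {linear E i -> Q i}) (b' : {linear Q i -> E i}),
    [/\ forall x, b' (a' x) = x,
        forall x, res_diff E i x = 0 -> ires_diff Q i (a' x) = 0 &
        forall y, ires_diff Q i y = 0 -> res_diff E i (b' y) = 0].
  by exists a', b'.
elim: i => [|i [a' [b' [ab' da qb]]]].
  have [||a' [b' [ab' a'd b'q]]] := retract_step (res_injective E 0%N)
      (ires_injective Q 0%N) (@res_ess0 A E) ab (q := ires_aug Q).
  - move=> x dx; have -> : x = 0; last by rewrite !linear0.
    by apply: (res_aug_inj E); rewrite linear0.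
  - move=> x dx; have -> : x = 0; last by rewrite !linear0.
    by apply: (ires_aug_inj Q); rewrite linear0.
  exists a', b'; split=> // x.
    move/(res_exact0 E) => [y <-]; rewrite a'd; apply/(ires_exact0 Q); by eexists.
  move/(ires_exact0 Q) => [y <-]; rewrite b'q; apply/(res_exact0 E); by eexists.
have [a2 [b2 [ab2 a2d b2q]]] := retract_step (res_injective E i.+1)
    (ires_injective Q i.+1) (@res_essS A E i) ab' da qb.
exists a2, b2; split=> // x.
  move/(res_exactS E) => [y <-]; rewrite a2d; apply/(ires_exactS Q); by eexists.
move/(ires_exactS Q) => [y <-]; rewrite b2q; apply/(res_exactS E); by eexists.
Qed.

Lemma chain_map_exists (U V : nat -> lmodType R)
    (u : forall i, {linear U i -> U i.+1}) (v : forall i, {linear V i -> V i.+1})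
    (phi0 : {linear U 0%N -> V 0%N}) :
    (forall i, exact_at (u i) (u i.+1)) ->
    (forall i x, v i.+1 (v i x) = 0) -> (forall i, injective_module (V i.+1)) ->
    (forall x, u 0%N x = 0 -> v 0%N (phi0 x) = 0) ->
  exists phi : forall i, {linear U i -> V i},
    (forall x, phi 0%N x = phi0 x) /\
    forall i x, phi i.+1 (u i x) = v i (phi i x).
Proof.
move=> exu vv injV uv0.
pose S i := {phi : {linear U i -> V i} | forall x, u i x = 0 -> v i (phi x) = 0}.
have step i (s : S i) : exists s' : S i.+1,
    forall x, sval s' (u i x) = v i (sval s x).
  have [psi psiE] := injective_factor (g := v i \o sval s : {linear U i -> V i.+1})
    (injV i) (svalP s).
  suff psiP x : u i.+1 x = 0 -> v i.+1 (psi x) = 0.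
    by exists (exist _ psi psiP) => x /=; rewrite psiE.
  by move/(exu i) => [y <-]; rewrite psiE /= vv.
pose next i (s : S i) : S i.+1 := projT1 (cid (step i s)).
pose fix phi i : S i := match i with 0%N => exist _ phi0 uv0 | j.+1 => next j (phi j) end.
exists (fun i => sval (phi i)); split=> // i x.
exact: (projT2 (cid (step i (phi i)))).
Qed.

(** The differential of the mapping cone of a chain map s : U -> V[1]; the sign
    makes it square to zero. *)
Definition cone_map (V V' U U' : lmodType R) (v : V -> V') (s : U -> V') (u : U -> U')
  (p : V * U) : V' * U' := (v p.1 + s p.2, - u p.2).

Lemma cone_map_linear (V V' U U' : lmodType R) (v : {linear V -> V'})
  (s : {linear U -> V'}) (u : {linear U -> U'}) : linear (cone_map v s u).
Proof.
move=> a [x y] [x' y']; congr (_, _) => /=.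
  by rewrite !linearP addrACA -scalerDr.
by rewrite linearP opprD scalerN.
Qed.
Definition cone (V V' U U' : lmodType R) (v : {linear V -> V'}) (s : {linear U -> V'})
  (u : {linear U -> U'}) : {linear (V * U)%type -> (V' * U')%type} :=
  mklin (cone_map_linear v s u).

Lemma cone_exact (V V' V'' U U' U'' : lmodType R)
    (v : {linear V -> V'}) (v' : {linear V' -> V''})
    (u : {linear U -> U'}) (u' : {linear U' -> U''}) (s : {linear U -> V'})
    (s' : {linear U' -> V''}) :
    exact_at v v' -> exact_at u u' -> (forall x, s' (u x) = v' (s x)) ->
  exact_at (cone v s u) (cone v' s' u').
Proof.
move=> exv exu su [y x]; split=> [[/= e1 /eqP]|[[y0 x0] [<- <-]]].
  rewrite oppr_eq0 => /eqP/exu[x0 x0E].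
  have /exv[y0 y0E] : v' (y + s x0) = 0 by rewrite linearD -su x0E.
  by exists (y0, - x0); rewrite /= /cone_map /= y0E !linearN opprK x0E addrK.
have vv z : v' (v z) = 0 by apply/exv; exists z.
have uu z : u' (u z) = 0 by apply/exu; exists z.
rewrite /= /cone_map /= (linearD v') (linearN s') (linearN u').
by rewrite uu vv su add0r subrr !oppr0.
Qed.

Lemma injective_prod X Y : injective_module X -> injective_module Y ->
  injective_module (X * Y)%type.
Proof.
move=> injX injY M N f g f_inj.
have [h hE] := injX M N f (fst \o g : {linear M -> X}) f_inj.
have [k kE] := injY M N f (snd \o g : {linear M -> Y}) f_inj.
have hk_lin : linear (fun y => (h y, k y)).
  by move=> a x y; rewrite !linearP.
exists (mklin hk_lin) => x /=.
by have /= -> := hE x; have /= -> := kE x; case: (g x).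
Qed.

(** * Resolutions of the members of a short exact sequence *)

Section ShortExact.
Variables (A B C : lmodType R) (f : {linear A -> B}) (g : {linear B -> C}).
Hypothesis fg : short_exact f g.

Section Kernel.
Variables (I : inj_resolution B) (J : inj_resolution C).

(** The mapping cone of a lift I -> J of B -> C, less the vanishing factor
    J_(-1) in degree 0. *)
Definition ker_term i : lmodType R :=
  match i with 0%N => I 0%N | j.+1 => (J j * I j.+1)%type end.

(** In positive degrees exactness is [cone_exact], except that in degree 1 the
    cone of the augmented complexes has C x I_0 in front instead of I_0. Both
    have the same image, as each c in C is the image of some b in B, whose
    augmentation in I_0 makes up for it. *)
Lemma kernel_resolution : exists Q : inj_resolution A, forall i, Q i = ker_term i.
Proof.
have [f_inj fg_ex g_surj] := fg.
have IB b : ires_aug I b = 0 -> b = 0.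
  by move=> e; apply: (ires_aug_inj I); rewrite linear0.
have JC c : ires_aug J c = 0 -> c = 0.
  by move=> e; apply: (ires_aug_inj J); rewrite linear0.
have II0 b : ires_diff I 0%N (ires_aug I b) = 0 by apply/(ires_exact0 I); exists b.
have JJ0 b : ires_diff J 0%N (ires_aug J b) = 0 by apply/(ires_exact0 J); exists b.
have JJ i x : ires_diff J i.+1 (ires_diff J i x) = 0 by apply/(ires_exactS J); exists x.
have [s0 s0E] := injective_factor (f := ires_aug I)
  (g := ires_aug J \o g : {linear B -> J 0%N}) (ires_injective J 0%N)
  (fun x e => etrans (congr1 _ (congr1 _ (IB x e))) (linear0 _)).
have [|s [sE0 sE]] := chain_map_exists (phi0 := s0) (ires_exactS I) JJ
    (fun i => ires_injective J i.+1).
  by move=> x /(ires_exact0 I)[b <-]; rewrite s0E JJ0.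
pose d0 x : J 0%N * I 1%N := (s 0%N x, - ires_diff I 0%N x).
have d0_lin : linear d0.
  by move=> a x y; congr (_, _) => /=; rewrite linearP // opprD scalerN.
pose d j : {linear ker_term j -> ker_term j.+1} :=
  match j with
  | 0%N => mklin d0_lin
  | i.+1 => cone (ires_diff J i) (s i.+1) (ires_diff I i.+1)
  end.
unshelve eexists (@InjResolution A ker_term
  (ires_aug I \o f : {linear A -> I 0%N}) d _ _ _ _) => //.
- case=> [|j]; first exact: ires_injective.
  exact: injective_prod (ires_injective J j) (ires_injective I j.+1).
- by move=> x y /= /(ires_aug_inj I) /f_inj.
- move=> x; split=> /=.
    case=> e /eqP; rewrite oppr_eq0 => /eqP/(ires_exact0 I)[b bx].
    move: e; rewrite -bx sE0 s0E => /JC/fg_ex[a ab].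
    by exists a; rewrite /= ab.
  case=> a <-; rewrite /d0 II0 sE0 s0E /= oppr0.
  by rewrite (_ : g (f a) = 0) ?linear0 //; apply/fg_ex; exists a.
- case=> [|j]; last first.
    by apply: cone_exact; [exact: ires_exactS|exact: ires_exactS|exact: sE].
  have cex := cone_exact (ires_exact0 J) (ires_exactS I 0%N) (sE 0%N).
  move=> y; apply: (iff_trans (cex y)); split=> [[[c x] <-]|[x <-]]; last first.
    by exists (0, x); rewrite /= /cone_map /= linear0 add0r.
  have [b bc] := g_surj c; exists (x + ires_aug I b).
  congr (_, _) => /=; last by rewrite (linearD (ires_diff I 0%N)) II0 addr0.
  by rewrite (linearD (s 0%N)) (sE0 (ires_aug I b)) s0E /= bc addrC.
Qed.
End Kernel.

Section Horseshoe.
Variables (I : inj_resolution A) (J : inj_resolution C).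

(** Extend the augmentation of A to t : B -> I_0. The differential of - t b
    vanishes on A, hence factors through C, and gives the connecting chain map
    s in degree 0. *)
Lemma horseshoe_resolution :
  exists Q : inj_resolution B, forall i, Q i = (I i * J i)%type.
Proof.
have [f_inj fg_ex g_surj] := fg.
have IA a : ires_aug I a = 0 -> a = 0.
  by move=> e; apply: (ires_aug_inj I); rewrite linear0.
have JC c : ires_aug J c = 0 -> c = 0.
  by move=> e; apply: (ires_aug_inj J); rewrite linear0.
have gf a : g (f a) = 0 by apply/fg_ex; exists a.
have II0 a : ires_diff I 0%N (ires_aug I a) = 0 by apply/(ires_exact0 I); exists a.
have JJ0 b : ires_diff J 0%N (ires_aug J b) = 0 by apply/(ires_exact0 J); exists b.
have II i x : ires_diff I i.+1 (ires_diff I i x) = 0 by apply/(ires_exactS I); exists x.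
have [t tE] := ires_injective I 0%N _ _ f (ires_aug I) f_inj.
have [|s0 s0E] := injective_factor (f := ires_aug J \o g : {linear B -> J 0%N})
    (g := \- (ires_diff I 0%N \o t) : {linear B -> I 1%N}) (ires_injective I 1%N).
  move=> b /JC/fg_ex[a <-] /=; have /= -> := tE a.
  by rewrite II0 oppr0.
have [||s [sE0 sE]] := chain_map_exists (U := J) (V := fun i => I i.+1)
    (v := fun i => ires_diff I i.+1) (phi0 := s0) (ires_exactS J) _
    (fun i => ires_injective I i.+2).
- by move=> i x; apply: II.
- move=> x /(ires_exact0 J)[c <-]; have [b <-] := g_surj c.
  by have /= -> := s0E b; rewrite linearN II oppr0.
pose aug b := (t b, ires_aug J (g b)).
have aug_lin : linear aug by move=> a x y; rewrite /aug !linearP.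
unshelve eexists (@InjResolution B (fun i => (I i * J i)%type) (mklin aug_lin)
  (fun j => cone (ires_diff I j) (s j) (ires_diff J j)) _ _ _ _) => //.
- by move=> j; apply: injective_prod; apply: ires_injective.
- apply: raddf_inj => b /= [tb /JC/fg_ex[a ab]].
  by move: tb; rewrite -ab; have /= -> := tE a; move/IA => ->; rewrite linear0.
- move=> [x y]; split=> [[/= e1 /eqP]|[b [<- <-]]].
    rewrite oppr_eq0 => /eqP/(ires_exact0 J)[c cy].
    have [b bc] := g_surj c; rewrite -cy -bc sE0 in e1 *.
    move: e1; have /= -> := s0E b; move/eqP; rewrite subr_eq0 => /eqP e1.
    have /(ires_exact0 I)[a ax] : ires_diff I 0%N (x - t b) = 0.
      by rewrite linearB e1 subrr.
    exists (f a + b); rewrite /= /aug !linearD gf linear0 add0r.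
    by have /= -> := tE a; rewrite ax subrK.
  by rewrite /= /cone_map /= JJ0 oppr0 sE0; have /= -> := s0E b; rewrite subrr.
- by move=> j; apply: cone_exact; [exact: ires_exactS|exact: ires_exactS|exact: sE].
Qed.
End Horseshoe.
End ShortExact.
End Resolutions.

(** * Direct summands of direct sums of copies *)

Section DirectSums.
Variable R : pzRingType.
Implicit Types M W X Y : lmodType R.

(** The complement is the kernel of the retraction. *)
Lemma iso_summandP X Y : iso_summand X Y <-> retract X Y.
Proof.
split=> [[Z [f [h fh hf]]]|[a [b ab]]].
  have a_lin : linear (fun x => f (x, 0)).
    by move=> c x y; rewrite -linearP; congr (f (_, _)); rewrite /= scaler0 addr0.
  have b_lin : linear (fun y => (h y).1).
    by move=> c x y; rewrite -{1}[x]hf -{1}[y]hf -linearP fh.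
  by exists (mklin a_lin), (mklin b_lin) => x /=; rewrite fh.
pose N := [set y | b y = 0]; have sN : submodule N.
  by split=> [|c x y xN yN]; rewrite /N /= ?linear0 // linearP xN yN scaler0 addr0.
pose f (p : X * smod sN) := a p.1 + smod_val p.2.
have f_lin : linear f.
  by move=> c [x y] [x' y']; rewrite /f /= linearP addrACA -scalerDr.
have Nres y : N (y - a (b y)) by rewrite /N /= linearB ab subrr.
exists (smod sN), (mklin f_lin).
exists (fun y => (b y, smk sN (Nres y))) => [[x z]|y]; rewrite /= /f /=.
  have bz : b (smod_val z) = 0 := smodP z.
  have bx : b (a x + smod_val z) = x by rewrite linearD ab bz addr0.
  by congr (_, _) => //; apply: val_inj; rewrite /= bx addrC addKr.
by rewrite addrC subrK.
Qed.

Section Map.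
Variables (K : Type) (M N : K -> lmodType R) (h : forall k, {linear M k -> N k}).

Fact dsum_map_fin (x : direct_sum M) : fin_supp (fun k => h k (x k)).
Proof.
by apply: sub_finite_set (dsum_fin x) => k /=; apply: contra_neq => ->; rewrite linear0.
Qed.
Definition dsum_map x : direct_sum N := DirectSum (dsum_map_fin x).

Lemma dsum_map_linear : linear dsum_map.
Proof. by move=> a x y; apply: dsum_ext => k /=; rewrite linearP. Qed.
End Map.

Lemma retract_dsum (K : Type) (M N : K -> lmodType R) :
  (forall k, retract (M k) (N k)) -> retract (direct_sum M) (direct_sum N).
Proof.
move=> MN; pose a k := projT1 (cid (MN k)).
pose b k := projT1 (cid (projT2 (cid (MN k)))).
exists (mklin (dsum_map_linear a)), (mklin (dsum_map_linear b)) => x.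
by apply: dsum_ext => k; exact: (projT2 (cid (projT2 (cid (MN k))))).
Qed.

(** Copies of W indexed by a disjoint union: this is how a product of two direct
    summands of copies of W is again one. *)
Section Sum.
Variables (K L : Type) (W : lmodType R).
Notation copies K := (direct_sum (fun _ : K => W)).

Fact dsum_pair_fin (p : copies K * copies L) :
  fin_supp (fun s => match s with inl k => p.1 k | inr l => p.2 l end).
Proof.
apply: (@sub_finite_set _ _ ([set inl k | k in [set k | p.1 k != 0]] `|`
                             [set inr l | l in [set l | p.2 l != 0]])).
  by case=> [k|l] /= nz; [left; exists k | right; exists l].
by rewrite finite_setU; split; apply: finite_image; apply: dsum_fin.
Qed.
Definition dsum_pair p : copies (K + L) := DirectSum (dsum_pair_fin p).

Lemma dsum_pair_linear : linear dsum_pair.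
Proof. by move=> a [x y] [x' y']; apply: dsum_ext => -[k|l]. Qed.

Fact dsum_inl_fin (x : copies (K + L)) : fin_supp (fun k => x (inl k)).
Proof.
rewrite /fin_supp -[X in finite_set X]/(inl @^-1` [set s | x s != 0]).
by apply: finite_preimage (dsum_fin x) => k l _ _ [].
Qed.
Fact dsum_inr_fin (x : copies (K + L)) : fin_supp (fun l => x (inr l)).
Proof.
rewrite /fin_supp -[X in finite_set X]/(inr @^-1` [set s | x s != 0]).
by apply: finite_preimage (dsum_fin x) => k l _ _ [].
Qed.
Definition dsum_split x : copies K * copies L :=
  (DirectSum (dsum_inl_fin x), DirectSum (dsum_inr_fin x)).

Lemma dsum_split_linear : linear dsum_split.
Proof. by move=> a x y; congr (_, _); apply: dsum_ext. Qed.

Lemma retract_copies_prod : retract (copies K * copies L)%type (copies (K + L)).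
Proof.
exists (mklin dsum_pair_linear), (mklin dsum_split_linear) => -[x y].
by congr (_, _); apply: dsum_ext.
Qed.
End Sum.

Fact fin_supp_finite (K : finType) (M : K -> lmodType R) (x : forall k, M k) :
  fin_supp x.
Proof. exact: finite_finset. Qed.

Definition fin_dsum (K : finType) (M : K -> lmodType R) (x : forall k, M k) :
  direct_sum M := DirectSum (fin_supp_finite x).

Lemma retract_dsum_widen (M : nat -> lmodType R) (m n : nat) : (m <= n)%N ->
  retract (direct_sum (fun j : 'I_m => M j)) (direct_sum (fun j : 'I_n => M j)).
Proof.
move=> mn.
pose ext (x : direct_sum (fun j : 'I_m => M j)) (j : 'I_n) : M j :=
  if @idP (j < m)%N is ReflectT jm then x (Ordinal jm) else 0.
have ext_lin : linear (fun x => fin_dsum (ext x)).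
  move=> a x y; apply: dsum_ext => j /=; rewrite /ext.
  by case: {-}_ / idP => //=; rewrite scaler0 addr0.
pose res (x : direct_sum (fun j : 'I_n => M j)) (j : 'I_m) : M j := x (widen_ord mn j).
have res_lin : linear (fun x => fin_dsum (res x)).
  by move=> a x y; apply: dsum_ext.
exists (mklin ext_lin), (mklin res_lin) => x; apply: dsum_ext => j /=.
rewrite /res /= /ext; case: {-}_ / idP => [jm|]; last by rewrite /= ltn_ord.
by case: j jm => j jm jm' /=; rewrite (bool_irrelevance jm jm').
Qed.

End DirectSums.

(** * The R_n-property *)

Section RnProperty.
Variable R : pzRingType.
Implicit Types (M X Y W : lmodType R) (J : min_inj_resolution R^o).

Lemma summand_of_copiesP X W : summand_of_copies X W <->
  exists K : Type, retract X (direct_sum (fun _ : K => W)).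
Proof. by split=> -[K /iso_summandP XW]; exists K. Qed.

Lemma summand_of_copies_retract X Y W :
  retract X Y -> summand_of_copies Y W -> summand_of_copies X W.
Proof.
move=> XY /summand_of_copiesP[K YW]; apply/summand_of_copiesP; exists K.
exact: retract_trans XY YW.
Qed.

Lemma summand_of_copies_mono X W W' :
  retract W W' -> summand_of_copies X W -> summand_of_copies X W'.
Proof.
move=> WW' /summand_of_copiesP[K XW]; apply/summand_of_copiesP; exists K.
exact/(retract_trans XW)/retract_dsum.
Qed.

Lemma retract_prod (X Y X' Y' : lmodType R) : retract X X' -> retract Y Y' ->
  retract (X * Y)%type (X' * Y')%type.
Proof.
move=> [a [b ab]] [c [d cd]].
have ac_lin : linear (fun p : X * Y => (a p.1, c p.2)).
  by move=> r x y; congr (_, _) => /=; rewrite linearP.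
have bd_lin : linear (fun p : X' * Y' => (b p.1, d p.2)).
  by move=> r x y; congr (_, _) => /=; rewrite linearP.
by exists (mklin ac_lin), (mklin bd_lin) => -[x y] /=; rewrite ab cd.
Qed.

Lemma summand_of_copies_prod X Y W : summand_of_copies X W ->
  summand_of_copies Y W -> summand_of_copies (X * Y)%type W.
Proof.
move=> /summand_of_copiesP[K XW] /summand_of_copiesP[L YW].
apply/summand_of_copiesP; exists (K + L)%type.
exact: retract_trans (retract_prod XW YW) (retract_copies_prod K L W).
Qed.

Definition first_terms J i : lmodType R := direct_sum (fun j : 'I_i.+1 => J j).

Lemma first_terms_mono J i j : (i <= j)%N ->
  retract (first_terms J i) (first_terms J j).
Proof. by move=> ij; apply: retract_dsum_widen. Qed.

Lemma first_terms_indep J J' i : retract (first_terms J i) (first_terms J' i).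
Proof.
apply: retract_dsum => j.
exact: (min_res_retract J (min_inj_resolution_forget J') j (retract_refl _)).
Qed.

(** The R_n-property read off from one resolution Q that need not be minimal,
    with one fixed minimal resolution J of R. *)
Definition Rn_resolution J n M (Q : inj_resolution M) :=
  forall i, (i < n)%N -> summand_of_copies (Q i) (first_terms J i).

(** From left to right the resolutions supplied by the property may differ from
    one i to the next; comparing minimal resolutions brings them back to one
    pair. From right to left the terms of a minimal resolution are direct
    summands of those of Q. *)
Lemma Rn_propertyP J n M :
  Rn_property n M <-> exists Q : inj_resolution M, Rn_resolution J n Q.
Proof.
have [E _] := min_inj_resolution_exists M.
split=> [MRn|[Q QRn] i lt_in].
  exists (min_inj_resolution_forget E) => i /MRn[E' [J' E'J']].
  apply: summand_of_copies_mono (first_terms_indep J' J i) _.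
  apply: summand_of_copies_retract E'J'.
  exact: (min_res_retract E (min_inj_resolution_forget E') i (retract_refl _)).
exists E, J; apply: summand_of_copies_retract (QRn i lt_in).
exact: min_res_retract (retract_refl _).
Qed.

Section Closure.
Variable n : nat.

Lemma Rn_property_kernel (A B C : lmodType R) (f : {linear A -> B})
    (g : {linear B -> C}) : short_exact f g ->
  Rn_property n B -> Rn_property n.-1 C -> Rn_property n A.
Proof.
have [J _] := min_inj_resolution_exists R^o.
move=> fg /(Rn_propertyP J)[I IRn] /(Rn_propertyP J)[L LRn].
apply/(Rn_propertyP J); have [Q QE] := kernel_resolution fg I L.
exists Q => -[|i] lt_in; rewrite QE /=; first exact: IRn.
apply: summand_of_copies_prod (IRn _ lt_in).
apply: summand_of_copies_mono (first_terms_mono J (leqnSn i)) _.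
by apply: LRn; case: (n) lt_in.
Qed.

Lemma Rn_property_extension (A B C : lmodType R) (f : {linear A -> B})
    (g : {linear B -> C}) : short_exact f g ->
  Rn_property n A -> Rn_property n C -> Rn_property n B.
Proof.
have [J _] := min_inj_resolution_exists R^o.
move=> fg /(Rn_propertyP J)[I IRn] /(Rn_propertyP J)[L LRn].
apply/(Rn_propertyP J); have [Q QE] := horseshoe_resolution fg I L.
by exists Q => i lt_in; rewrite QE; apply: summand_of_copies_prod; auto.
Qed.

Lemma Rn_property_retract (A B : lmodType R) :
  retract A B -> Rn_property n B -> Rn_property n A.
Proof.
have [J _] := min_inj_resolution_exists R^o.
have [E _] := min_inj_resolution_exists A.
move=> AB /(Rn_propertyP J)[Q QRn]; apply/(Rn_propertyP J).
exists (min_inj_resolution_forget E) => i /QRn.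
by apply: summand_of_copies_retract; apply: min_res_retract.
Qed.

Lemma Rn_property_prod X Y :
  Rn_property n X -> Rn_property n Y -> Rn_property n (X * Y)%type.
Proof.
have inl_lin : linear (fun x : X => (x, 0 : Y)).
  by move=> a x y; congr (_, _); rewrite /= scaler0 addr0.
have snd_lin : linear (snd : X * Y -> Y) by [].
apply: (Rn_property_extension (f := mklin inl_lin) (g := mklin snd_lin)); split.
- by move=> x y [].
- by move=> [x y]; split=> /= [->|[z [_ <-]]] //; exists x.
- by move=> y; exists (0, y).
Qed.

(** I_i(R) is one of the factors of W_i. *)
Lemma Rn_property_ring : @Rn_property R n R^o.
Proof.
have [J _] := min_inj_resolution_exists R^o; apply/(Rn_propertyP J).
exists (min_inj_resolution_forget J) => i _; apply/summand_of_copiesP; exists unit.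
apply: (@retract_trans _ (first_terms J i)).
  have at_lin : linear (fun x : first_terms J i => x ord_max) by [].
  pose put (x : J i) (j : 'I_i.+1) : J j :=
    if @eqP nat i j is ReflectT ij then ecast k (J k) ij x else 0.
  have put_lin : linear (fun x => fin_dsum (put x)).
    move=> a x y; apply: dsum_ext => j; rewrite /= /put.
    by case: {-}_ / eqP => [ij|_]; [case: _ / ij | rewrite scaler0 addr0].
  exists (mklin put_lin), (mklin at_lin) => x /=; rewrite /put /=.
  by case: {-}_ / eqP => // ii; rewrite eq_axiomK.
have cst_lin :
    linear (fun x => @fin_dsum R unit (fun=> first_terms J i) (fun=> x)).
  by move=> a x y; apply: dsum_ext.
have at_lin : linear (fun x : direct_sum (fun _ : unit => first_terms J i) => x tt).
  by [].
by exists (mklin cst_lin), (mklin at_lin).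
Qed.

(** F is a free module on the entries of s, built one rank at a time so that
    closure under products applies. *)
Lemma Rn_property_cover M (s : seq M) : exists F : lmodType R,
  Rn_property n F /\ exists h : {linear F -> M},
    forall c : nat -> R, exists x, h x = \sum_(i < size s) c i *: s`_i.
Proof.
elim: s => [|m s [F [FRn [h hE]]]].
  have o_lin : linear (fun _ : R^o => 0 : M) by move=> a x y; rewrite scaler0 addr0.
  exists R^o; split; first exact: Rn_property_ring.
  by exists (mklin o_lin) => c; exists 0; rewrite big_ord0.
have k_lin : linear (fun p : R^o * F => (p.1 : R) *: m + h p.2).
  move=> a [r x] [r' x']; rewrite /= linearP scalerDl -scalerA addrACA.
  by rewrite -scalerDr.
exists (R^o * F)%type; split; first exact: Rn_property_prod Rn_property_ring FRn.
exists (mklin k_lin) => c; have [x hx] := hE (fun i => c i.+1).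
by exists (c 0%N, x); rewrite /= hx big_ord_recl.
Qed.

Lemma Rn_property_projective M : fin_gen M -> projective_module M -> Rn_property n M.
Proof.
move=> [s s_gen] projM; have [F [FRn [h hE]]] := Rn_property_cover s.
have [|k hk] := projM F M h idfun.
  by move=> y; have [c ->] := (s_gen y).1 isT; apply: hE.
by apply: Rn_property_retract FRn; exists k, h.
Qed.

End Closure.
End RnProperty.

Theorem proposition2p4 (R : pzRingType) (hl : left_noetherian R)
    (hr : right_noetherian R) (n : nat) (hn : (1 <= n)%N) :
  (forall (A B C : lmodType R) (f : {linear A -> B}) (g : {linear B -> C}),
     fin_gen A -> fin_gen B -> fin_gen C -> short_exact f g ->
     Rn_mod n B -> Rn_mod n.-1 C -> Rn_mod n A)
  /\ resolving (@Rn_mod R n).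
Proof.
split=> [A B C f g fgA _ _ fg [_ BRn] [_ CRn]|].
  by split=> //; apply: Rn_property_kernel fg BRn CRn.
split=> [M [] //|P fgP projP|A B C f g _ fgB _ fg [_ ARn] [_ CRn]|].
- by split=> //; apply: Rn_property_projective.
- by split=> //; apply: Rn_property_extension fg ARn CRn.
move=> A B C f g fgA _ _ fg [_ BRn] [_ CRn]; split=> //.
apply: Rn_property_kernel fg BRn _ => i lt_in; apply: CRn.
exact: leq_trans lt_in (leq_pred n).
Qed.
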